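(* Let $\mathfrak{s}=\mathbb{R}e_0\ltimes_A\mathbb{R}^{11}$ be a $12$-dimensional almost abelian Lie algebra admitting a hypercomplex structure $\{J_\alpha\}$, with $$A=\begin{bmatrix}\mu I_3&0\\ V&B_1\end{bmatrix},\qquad B_1=K(a_1,b_1)\oplus K(a_2,b_2),$$ where $\mu,a_1,a_2,b_1,b_2\in\mathbb{R}$, $b_1,b_2\ge0$, and $V$ is the $8\times3$ matrix with columns $J_1v_0,J_2v_0,J_3v_0$ for some $v_0\in\mathbb{R}^8$. Then $\mathfrak{s}$ is isomorphic to one and only one of the following Lie algebras: $\mathfrak{s}_1^{a,c,d}$: $-f^0\wedge(0,0,0,0\,|\,af^4-f^5,f^4+af^5,af^6+f^7,-f^6+af^7\,|\,cf^8-df^9,df^8+cf^9,cf^{10}+df^{11},-df^{10}+cf^{11})$, $a,c\in\mathbb{R}$, $d>1$; $\mathfrak{s}_2^{a,c}$: $-f^0\wedge(0,0,0,0\,|\,af^4-f^5,f^4+af^5,af^6+f^7,-f^6+af^7\,|\,cf^8-f^9,f^8+cf^9,cf^{10}+f^{11},-f^{10}+cf^{11})$, with $0\le a\le c$, or $a<0<c$ and $|a|\le|c|$; $\mathfrak{s}_3^{a,b,c,d}$: $-f^0\wedge(0,f^1,f^2,f^3\,|\,af^4-bf^5,bf^4+af^5,af^6+bf^7,-bf^6+af^7\,|\,cf^8-df^9,df^8+cf^9,cf^{10}+df^{11},-df^{10}+cf^{11})$, $a,c\in\mathbb{R}$, $0<b<d$; $\mathfrak{s}_4^{a,b,c}$: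 $-f^0\wedge(0,f^1,f^2,f^3\,|\,af^4-bf^5,bf^4+af^5,af^6+bf^7,-bf^6+af^7\,|\,cf^8-bf^9,bf^8+cf^9,cf^{10}+bf^{11},-bf^{10}+cf^{11})$, $a\le c$, $b>0$; $\mathfrak{s}_5^{a,c}$: $-f^0\wedge(0,0,0,0\,|\,af^4,af^5,af^6,af^7\,|\,cf^8-f^9,f^8+cf^9,cf^{10}+f^{11},-f^{10}+cf^{11})$, with $a\ne0$ and $c\in\mathbb{R}$, or $a=0$ and $c\ge0$; $\mathfrak{s}_6^{c}$: $-f^0\wedge(0,0,0,0\,|\,0,f^1,f^2,f^3\,|\,cf^8-f^9,f^8+cf^9,cf^{10}+f^{11},-f^{10}+cf^{11})$, $c\ge0$; $\mathfrak{s}_7^{a,c,d}$: $-f^0\wedge(0,f^1,f^2,f^3\,|\,af^4,af^5,af^6,af^7\,|\,cf^8-df^9,df^8+cf^9,cf^{10}+df^{11},-df^{10}+cf^{11})$, $a,c\in\mathbb{R}$, $d>0$; $\mathfrak{s}_8^{c,d}$: $-f^0\wedge(0,f^1,f^2,f^3\,|\,f^4,f^1+f^5,f^2+f^6,f^3+f^7\,|\,cf^8-df^9,df^8+cf^9,cf^{10}+df^{11},-df^{10}+cf^{11})$, $c\in\mathbb{R}$, $d>0$; $\mathfrak{s}_9^{c}$: $-f^0\wedge(0,0,0,0\,|\,f^4,f^5,f^6,f^7\,|\,cf^8,cf^9,cf^{10},cf^{11})$, $|c|\le1$; $\mathfrak{s}_{10}^{c}$: $-f^0\wedge(0,0,0,0\,|\,0,f^1,f^2,f^3\,|\,cf^8,cf^9,cf^{10},cf^{11})$,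 $c=0$ or $1$; $\mathfrak{s}_{11}^{a,c}$: $-f^0\wedge(0,f^1,f^2,f^3\,|\,af^4,af^5,af^6,af^7\,|\,cf^8,cf^9,cf^{10},cf^{11})$, $a\le c$; $\mathfrak{s}_{12}^{c}$: $-f^0\wedge(0,f^1,f^2,f^3\,|\,f^4,f^1+f^5,f^2+f^6,f^3+f^7\,|\,cf^8,cf^9,cf^{10},cf^{11})$, $c\in\mathbb{R}$.
   Context: A Lie algebra is almost abelian if it has a codimension one abelian ideal. $\mathbb{R}e_0\ltimes_A\mathbb{R}^{11}$ is the Lie algebra with $\mathbb{R}^{11}$ an abelian ideal and $[e_0,v]=Av$. A hypercomplex structure on a Lie algebra is a triple $\{J_1,J_2,J_3\}$ of integrable (vanishing Nijenhuis tensor) complex structures on it with $J_1J_2=-J_2J_1=J_3$. $M_1\oplus M_2$ denotes the block diagonal matrix. For real $a,b$, $$K(a,b)=\begin{bmatrix}a&-b&0&0\\ b&a&0&0\\ 0&0&a&b\\ 0&0&-b&a\end{bmatrix}.$$ The subspace $\mathbb{R}^8\subset\mathbb{R}^{11}$ on which $B_1$ acts is invariant under each $J_\alpha$ and has ordered basis $u_0,u_1,u_2,u_3,w_0,w_1,w_2,w_3$ with $J_\alpha u_0=u_\alpha$, $J_\alpha w_0=w_\alpha$ ($\alpha=1,2,3$); $B_1$ commutes with the restriction of each $J_\alpha$ to $\mathbb{R}^8$. Notation for Lie algebras: $-f^0\wedge(\alpha_0,\dots,\alpha_3\,|\,\alpha_4,\dots,\alpha_7\,|\,\alpha_8,\dots,\alpha_{11})$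 denotes the $12$-dimensional Lie algebra with basis $f_0,\dots,f_{11}$ and dual basis $f^0,\dots,f^{11}$ such that $df^i=-f^0\wedge\alpha_i$ for $0\le i\le11$, i.e. $[f_0,f_j]=\sum_{i}\alpha_i(f_j)f_i$ for $1\le j\le11$ and $[f_j,f_k]=0$ for $1\le j,k\le11$.
   Formalization: The Lie algebra is assumed non-abelian (the abelian one, A=0, is not in the list), and uniqueness of family and parameters is stated up to the isomorphisms s_1^{a,c,d} ≅ s_1^{-a,-c,d} and s_5^{a,c} ≅ s_5^{-a,-c}, both members of which are in the list. *)

(* Defs.v *)
From HB Require Import structures.
From mathcomp Require Import all_boot all_order all_algebra.
From mathcomp Require Import reals.

Set Implicit Arguments.
Unset Strict Implicit.
Unset Printing Implicit Defensive.

Import Order.TTheory GRing.Theory Num.Theory.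
Local Open Scope ring_scope.

Record lieAlgebra (F : fieldType) := LieAlgebra {
  lie_sort :> vectType F;
  lie_bracket : lie_sort -> lie_sort -> lie_sort;
  lie_linearl : forall y, linear (lie_bracket^~ y);
  lie_linearr : forall x, linear (lie_bracket x);
  lie_alternating : forall x, lie_bracket x x = 0;
  lie_jacobi : forall x y z,
    lie_bracket x (lie_bracket y z) + lie_bracket y (lie_bracket z x)
      + lie_bracket z (lie_bracket x y) = 0 }.

Arguments lie_bracket {F l} x y.

Notation "''Lie' [ x , y ]" := (lie_bracket x y)
  (at level 0, x, y at level 99, format "''Lie' [ x ,  y ]") : ring_scope.

Section LieNotions.
Variable F : fieldType.

Definition lie_abelian (L : lieAlgebra F) : Prop := forall x y : L, 'Lie[x, y] = 0.

Definition lie_isomorphic (L M : lieAlgebra F) : Prop :=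
  exists2 f : 'Hom(L, M), bijective f & forall x y : L, f 'Lie[x, y] = 'Lie[f x, f y].

Definition nijenhuis (L : lieAlgebra F) (J : 'End(L)) (x y : L) : L :=
  'Lie[J x, J y] - J 'Lie[J x, y] - J 'Lie[x, J y] - 'Lie[x, y].

Definition complex_structure (L : lieAlgebra F) (J : 'End(L)) : Prop :=
  (forall x, J (J x) = - x) /\ (forall x y, nijenhuis J x y = 0).

(* The index set is {0, 1, 2}: [J 0], [J 1], [J 2] are J_1, J_2, J_3. *)
Definition hypercomplex_structure (L : lieAlgebra F) (J : 'I_3 -> 'End(L)) : Prop :=
  [/\ forall k, complex_structure (J k),
      forall x, J 0 (J 1 x) = J 2 x
    & forall x, J 1 (J 0 x) = - J 2 x].

End LieNotions.

Section SemidirectProduct.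
Variables (F : fieldType) (n : nat) (A : 'M[F]_n).

(* F e_0 |x_A F^n: the pair (s, v) is s e_0 + v, and [e_0, v] = A v. *)
Let V : vectType F := (F^o * 'cV[F]_n)%type.

Let br (x y : V) : V := (0, x.1 *: (A *m y.2) - y.1 *: (A *m x.2)).

Fact semidirect_linearl y : linear (br^~ y).
Proof.
move=> k x x'; rewrite /br; congr pair; rewrite /= ?scaler0 ?addr0 //.
rewrite mulmxDr -scalemxAr scalerDr scalerDl scalerBr !scalerA opprD addrACA.
by rewrite [y.1 * k]mulrC.
Qed.

Fact semidirect_linearr x : linear (br x).
Proof.
move=> k y y'; rewrite /br; congr pair; rewrite /= ?scaler0 ?addr0 //.
rewrite mulmxDr -scalemxAr scalerDr scalerDl scalerBr !scalerA opprD addrACA.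
by rewrite [x.1 * k]mulrC.
Qed.

Fact semidirect_alternating x : br x x = 0.
Proof. by rewrite /br subrr. Qed.

Fact semidirect_jacobi x y z :
  br x (br y z) + br y (br z x) + br z (br x y) = 0.
Proof.
rewrite /br; congr pair; rewrite /= ?addr0 // !scale0r !subr0.
rewrite !mulmxBr -!scalemxAr !scalerBr !scalerA.
rewrite [z.1 * x.1]mulrC [z.1 * y.1]mulrC [y.1 * x.1]mulrC.
set a := (x.1 * y.1) *: _; set b := (x.1 * z.1) *: _.
set c := (y.1 * z.1) *: _.
by rewrite [a - b + _]addrC !subrKA subrr.
Qed.

Definition semidirect : lieAlgebra F :=
  LieAlgebra semidirect_linearl semidirect_linearr
             semidirect_alternating semidirect_jacobi.

End SemidirectProduct.

Section DualBasisNotation.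
Variables (F : fieldType) (n : nat).

(* A linear form on F^(n+1) is a row vector; [dual j] is f^j.  A list of
   forms [alpha] stands for (alpha_0, ..., alpha_n). *)
Definition dual (j : nat) : 'rV[F]_n.+1 := \row_k (k == j :> nat)%:R.

Definition forms_mx (alpha : seq 'rV[F]_n.+1) : 'M[F]_n.+1 :=
  \matrix_(i < n.+1) alpha`_i.

Variables (alpha : seq 'rV[F]_n.+1) (alpha0 : alpha`_0 = 0).

(* The i-th coordinate of [x, y] is - df^i (x, y) = (f^0 /\ alpha_i)(x, y).
   Jacobi holds because alpha_0 = 0. *)
Let br (x y : 'cV[F]_n.+1) : 'cV[F]_n.+1 :=
  x 0 0 *: (forms_mx alpha *m y) - y 0 0 *: (forms_mx alpha *m x).

Fact coframe_linearl y : linear (br^~ y).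
Proof.
move=> k x x'; rewrite /br !mxE.
rewrite mulmxDr -scalemxAr scalerDr scalerDl scalerBr !scalerA opprD addrACA.
by rewrite [y 0 0 * k]mulrC.
Qed.

Fact coframe_linearr x : linear (br x).
Proof.
move=> k y y'; rewrite /br !mxE.
rewrite mulmxDr -scalemxAr scalerDr scalerDl scalerBr !scalerA opprD addrACA.
by rewrite [x 0 0 * k]mulrC.
Qed.

Fact coframe_alternating x : br x x = 0.
Proof. by rewrite /br subrr. Qed.

Fact coframe_bracket_f0 x y : br x y 0 0 = 0.
Proof.
have r0 z : (forms_mx alpha *m z) 0 0 = 0.
  by rewrite mxE big1 // => j _; rewrite mxE /= alpha0 mxE mul0r.
have brE a b (v w : 'cV[F]_n.+1) :
  (a *: v - b *: w) 0 0 = a * v 0 0 - b * w 0 0 by rewrite !mxE.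
by rewrite /br brE !r0 !mulr0 subr0.
Qed.

Fact coframe_jacobi x y z :
  br x (br y z) + br y (br z x) + br z (br x y) = 0.
Proof.
have brE u v w : br u (br v w) = u 0 0 *: (forms_mx alpha *m br v w).
  by rewrite {1}/br coframe_bracket_f0 scale0r subr0.
rewrite !brE !mulmxBr -!scalemxAr !scalerBr !scalerA.
rewrite [z 0 0 * x 0 0]mulrC [z 0 0 * y 0 0]mulrC [y 0 0 * x 0 0]mulrC.
set a := (x 0 0 * y 0 0) *: _; set b := (x 0 0 * z 0 0) *: _.
set c := (y 0 0 * z 0 0) *: _.
by rewrite [a - b + _]addrC !subrKA subrr.
Qed.

Definition coframe_lie : lieAlgebra F :=
  @LieAlgebra F 'cV[F]_n.+1 br coframe_linearl coframe_linearr
              coframe_alternating coframe_jacobi.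

End DualBasisNotation.

Section Data.
Variable F : fieldType.

Definition Kmx (a b : F) : 'M[F]_4 :=
  \matrix_(i < 4, j < 4) (nth [::] [:: [:: a; - b;   0; 0];
                                      [:: b;   a;   0; 0];
                                      [:: 0;   0;   a; b];
                                      [:: 0;   0; - b; a]] i)`_j.

Definition B1mx (a1 b1 a2 b2 : F) : 'M[F]_(4 + 4) :=
  block_mx (Kmx a1 b1) 0 0 (Kmx a2 b2).

Definition Amx (mu : F) (V : 'M[F]_(4 + 4, 3)) (B : 'M[F]_(4 + 4)) :
  'M[F]_(3 + (4 + 4)) := block_mx mu%:M 0 V B.

Definition incl8 (A : 'M[F]_(3 + (4 + 4))) (v : 'cV[F]_(4 + 4)) : semidirect A :=
  (0, col_mx 0 v).

Definition u_ (i : 'I_4) : 'cV[F]_(4 + 4) := delta_mx (lshift 4 i) 0.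
Definition w_ (i : 'I_4) : 'cV[F]_(4 + 4) := delta_mx (rshift 4 i) 0.

End Data.

Inductive label (R : Type) : Type :=
| S1 of R & R & R
| S2 of R & R
| S3 of R & R & R & R
| S4 of R & R & R
| S5 of R & R
| S6 of R
| S7 of R & R & R
| S8 of R & R
| S9 of R
| S10 of R
| S11 of R & R
| S12 of R.

Section List12.
Variable R : realFieldType.

Local Notation f := (@dual R 11).
Local Notation "'[-' 'f0' '/\' s ']'" :=
  (@coframe_lie R 11 s (erefl _)) (at level 0, s at level 99).

Definition s_ (l : label R) : lieAlgebra R :=
  match l with
  | S1 a c d => [- f0 /\ [:: 0; 0; 0; 0;
      a *: f 4 - f 5; f 4 + a *: f 5; a *: f 6 + f 7; - f 6 + a *: f 7;
      c *: f 8 - d *: f 9; d *: f 8 + c *: f 9;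
      c *: f 10 + d *: f 11; - (d *: f 10) + c *: f 11]]
  | S2 a c => [- f0 /\ [:: 0; 0; 0; 0;
      a *: f 4 - f 5; f 4 + a *: f 5; a *: f 6 + f 7; - f 6 + a *: f 7;
      c *: f 8 - f 9; f 8 + c *: f 9; c *: f 10 + f 11; - f 10 + c *: f 11]]
  | S3 a b c d => [- f0 /\ [:: 0; f 1; f 2; f 3;
      a *: f 4 - b *: f 5; b *: f 4 + a *: f 5;
      a *: f 6 + b *: f 7; - (b *: f 6) + a *: f 7;
      c *: f 8 - d *: f 9; d *: f 8 + c *: f 9;
      c *: f 10 + d *: f 11; - (d *: f 10) + c *: f 11]]
  | S4 a b c => [- f0 /\ [:: 0; f 1; f 2; f 3;
      a *: f 4 - b *: f 5; b *: f 4 + a *: f 5;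
      a *: f 6 + b *: f 7; - (b *: f 6) + a *: f 7;
      c *: f 8 - b *: f 9; b *: f 8 + c *: f 9;
      c *: f 10 + b *: f 11; - (b *: f 10) + c *: f 11]]
  | S5 a c => [- f0 /\ [:: 0; 0; 0; 0;
      a *: f 4; a *: f 5; a *: f 6; a *: f 7;
      c *: f 8 - f 9; f 8 + c *: f 9; c *: f 10 + f 11; - f 10 + c *: f 11]]
  | S6 c => [- f0 /\ [:: 0; 0; 0; 0;
      0; f 1; f 2; f 3;
      c *: f 8 - f 9; f 8 + c *: f 9; c *: f 10 + f 11; - f 10 + c *: f 11]]
  | S7 a c d => [- f0 /\ [:: 0; f 1; f 2; f 3;
      a *: f 4; a *: f 5; a *: f 6; a *: f 7;
      c *: f 8 - d *: f 9; d *: f 8 + c *: f 9;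
      c *: f 10 + d *: f 11; - (d *: f 10) + c *: f 11]]
  | S8 c d => [- f0 /\ [:: 0; f 1; f 2; f 3;
      f 4; f 1 + f 5; f 2 + f 6; f 3 + f 7;
      c *: f 8 - d *: f 9; d *: f 8 + c *: f 9;
      c *: f 10 + d *: f 11; - (d *: f 10) + c *: f 11]]
  | S9 c => [- f0 /\ [:: 0; 0; 0; 0;
      f 4; f 5; f 6; f 7;
      c *: f 8; c *: f 9; c *: f 10; c *: f 11]]
  | S10 c => [- f0 /\ [:: 0; 0; 0; 0;
      0; f 1; f 2; f 3;
      c *: f 8; c *: f 9; c *: f 10; c *: f 11]]
  | S11 a c => [- f0 /\ [:: 0; f 1; f 2; f 3;
      a *: f 4; a *: f 5; a *: f 6; a *: f 7;
      c *: f 8; c *: f 9; c *: f 10; c *: f 11]]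
  | S12 c => [- f0 /\ [:: 0; f 1; f 2; f 3;
      f 4; f 1 + f 5; f 2 + f 6; f 3 + f 7;
      c *: f 8; c *: f 9; c *: f 10; c *: f 11]]
  end.

Definition admissible (l : label R) : Prop :=
  match l with
  | S1 a c d => 1 < d
  | S2 a c => 0 <= a <= c \/ [/\ a < 0, 0 < c & `|a| <= `|c|]
  | S3 a b c d => 0 < b < d
  | S4 a b c => a <= c /\ 0 < b
  | S5 a c => a != 0 \/ (a = 0 /\ 0 <= c)
  | S6 c => 0 <= c
  | S7 a c d => 0 < d
  | S8 c d => 0 < d
  | S9 c => `|c| <= 1
  | S10 c => c = 0 \/ c = 1
  | S11 a c => a <= c
  | S12 c => True
  end.

(* Replacing f_0 by -f_0 identifies s_1^{a,c,d} with s_1^{-a,-c,d} and s_5^{a,c}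
   with s_5^{-a,-c}; both members of such a pair are in the list. *)
Definition sign_twins (l l' : label R) : Prop :=
  match l, l' with
  | S1 a c d, S1 a' c' d' => [/\ a' = - a, c' = - c & d' = d]
  | S5 a c, S5 a' c' => a' = - a /\ c' = - c
  | _, _ => False
  end.

End List12.

(* Main.v *)
Require Import Defs.
From HB Require Import structures.
From mathcomp Require Import all_boot all_order all_algebra.
From mathcomp Require Import reals ring lra.
From mathcomp Require complex.

(* An isomorphism R e_0 |x_A R^n -> R f_0 |x_N R^n that maps R^n onto R^n
   restricts to an invertible P with P A = t N P, where f e_0 = t f_0 mod R^n;
   and it must map R^n onto R^n as soon as rank N > 2.  So the classification is
   that of the matrices A up to conjugation and rescaling.

   In the quaternionic basis each half of V has columns i v, j v, k v.  The
   conjugation by [1 0; X 1] removes the half of V facing K(a,b) when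
   K(a,b) - mu is invertible or v = 0; otherwise K(a,b) = mu I commutes with
   everything, and conjugating by the inverse of [v | i v | j v | k v] turns that
   half into the coordinate inclusion (and then clears the other one, if needed).

   The normal forms are told apart by the characteristic polynomial
   (X - mu)^3 q_1^2 q_2^2, q_i = (X - a_i)^2 + b_i^2, in which mu is the only
   real root of odd multiplicity, and by rank (A - mu), which is 3 or 0 modulo 4
   according to whether or not the nilpotent part survives. *)

Set Implicit Arguments.
Unset Strict Implicit.
Unset Printing Implicit Defensive.

Import Order.TTheory GRing.Theory Num.Theory.
Local Open Scope ring_scope.

(** * Line similarity and isomorphism *)

Section LineSimilarity.
Variables (F : fieldType) (n : nat).
Implicit Types A B C P N : 'M[F]_n.

Definition line_similar A B : Prop :=
  exists t : F, exists2 P : 'M[F]_n, t != 0 /\ P \in unitmx & P *m A = t *: (B *m P).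

Lemma line_similar_trans A B C :
  line_similar A B -> line_similar B C -> line_similar A C.
Proof.
case=> t [P [t0 uP] eP] [s [Q [s0 uQ] eQ]].
exists (t * s); exists (Q *m P).
  by rewrite mulf_neq0 // unitmx_mul uP uQ.
by rewrite -mulmxA eP -scalemxAr (mulmxA Q) eQ -scalemxAl scalerA mulmxA.
Qed.

Lemma line_similar_sym A B : line_similar A B -> line_similar B A.
Proof.
case=> t [P [t0 uP] eP]; exists t^-1; exists (invmx P).
  by rewrite invr_neq0 ?unitmx_inv.
rewrite -[A in RHS](mulKmx uP) eP -scalemxAr -scalemxAl scalerA mulVf // scale1r.
by rewrite -!mulmxA mulmxV // mulmx1.
Qed.

Lemma line_similarZ t A : t != 0 -> line_similar A (t *: A).
Proof.
move=> t0; exists t^-1; exists 1%:M; first by rewrite invr_neq0 ?unitmx1.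
by rewrite mul1mx mulmx1 scalerA mulVf // scale1r.
Qed.

Lemma line_similar_refl A : line_similar A A.
Proof. by exists 1; exists 1%:M; rewrite ?oner_neq0 ?unitmx1 // mul1mx mulmx1 scale1r. Qed.

Lemma line_similar_conj A B P :
  P \in unitmx -> P *m A = B *m P -> line_similar A B.
Proof. by move=> uP e; exists 1; exists P; rewrite ?oner_neq0 ?scale1r. Qed.

Lemma unitmx_injective P : (forall v : 'cV_n, P *m v = 0 -> v = 0) -> P \in unitmx.
Proof.
move=> injP; rewrite -unitmx_tr -row_free_unit -kermx_eq0.
apply/rowV0P => u /sub_kermxP /(congr1 trmx).
by rewrite trmx_mul trmxK trmx0 => /injP /(congr1 trmx); rewrite trmxK trmx0.
Qed.

End LineSimilarity.

Section CoframeIsomorphism.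
Variables (F : fieldType) (n : nat) (A N : 'M[F]_n).
Variables (alpha : seq 'rV[F]_n.+1) (alpha0 : alpha`_0 = 0).
Hypothesis alphaN : forms_mx alpha = block_mx (0 : 'M_1) 0 0 N :> 'M_(1 + n).

Let M : 'M[F]_n.+1 := forms_mx alpha.

Lemma coframe_bracketE (x y : coframe_lie alpha0) :
  'Lie[x, y] = (x : 'cV_n.+1) 0 0 *: (M *m y) - (y : 'cV_n.+1) 0 0 *: (M *m x).
Proof. by []. Qed.

Lemma semidirect_bracketE (x y : semidirect A) :
  'Lie[x, y] = (0, x.1 *: (A *m y.2) - y.1 *: (A *m x.2)).
Proof. by []. Qed.

Lemma forms_mulE (a : 'cV[F]_1) (v : 'cV[F]_n) :
  M *m (col_mx a v : 'cV_(1 + n)) = (col_mx 0 (N *m v) : 'cV_(1 + n)).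
Proof.
have := mul_block_col (0 : 'M_1) 0 0 N a v; rewrite !mul0mx !add0r => <-.
by rewrite /M alphaN.
Qed.

Lemma col_mx00 (a : 'cV[F]_1) (v : 'cV[F]_n) :
  (col_mx a v : 'cV_(1 + n)) 0 0 = a 0 0.
Proof.
have -> : (0 : 'I_(1 + n)) = lshift n (0 : 'I_1) by apply/val_inj.
by rewrite col_mxEu.
Qed.

(** The isomorphism is (s, v) |-> (t s, P v): it carries [e_0, v] = A v to P A v = t N P v =
    [t f_0, P v]. *)
Lemma line_similar_iso :
  line_similar A N -> lie_isomorphic (semidirect A) (coframe_lie alpha0).
Proof.
case=> t [P [t0 uP] eP].
pose f (x : semidirect A) : coframe_lie alpha0 :=
  (col_mx (t * x.1)%:M (P *m x.2) : 'cV_(1 + n)).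
have lf : linear f.
  move=> k x y; rewrite /f /= -[RHS]/(k *: col_mx _ _ + col_mx _ _ : 'cV_(1 + n)).
  rewrite scale_col_mx add_col_mx; apply: (congr2 (@col_mx F 1 n 1)); last first.
    by rewrite mulmxDr scalemxAr.
  by rewrite scale_scalar_mx -raddfD /= mulrDr mulrCA.
pose lL := GRing.isLinear.Build F _ _ _ f lf.
pose fL : {linear semidirect A -> coframe_lie alpha0} := HB.pack f lL.
have fE x : linfun fL x = f x by rewrite lfunE.
exists (linfun fL).
  pose g (y : coframe_lie alpha0) : semidirect A :=
    (t^-1 * (y : 'cV_n.+1) 0 0, invmx P *m dsubmx (y : 'cV_(1 + n))).
  exists g => [x|y]; rewrite fE /f /g.
    rewrite col_mx00 col_mxKd mxE eqxx mulr1n mulKf // mulKmx //.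
    by case: x.
  rewrite /= mulVKf // mulKVmx //.
  rewrite -[RHS](@vsubmxK _ 1 n 1); apply: (congr2 (@col_mx F 1 n 1)) => //.
  apply/matrixP=> i j; rewrite !ord1 !mxE eqxx mulr1n; congr (y _ _).
  exact/val_inj.
move=> x y; rewrite !fE semidirect_bracketE coframe_bracketE /f !forms_mulE !col_mx00.
rewrite !mxE eqxx !mulr1n /= -[RHS]/(_ *: col_mx _ _ - _ *: col_mx _ _ : 'cV_(1 + n)).
rewrite !scale_col_mx opp_col_mx add_col_mx; apply: (congr2 (@col_mx F 1 n 1)).
  by rewrite mulr0 !scaler0 oppr0 addr0 raddf0.
by rewrite mulmxBr -!scalemxAr !mulmxA eP -!scalemxAl !scalerA ![t * _]mulrC.
Qed.

(** Suppose that the image of some v in F^n had a nonzero f_0-coordinate. Since v commutes with all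
    of F^n, [M] would map the image of F^n to the line of M f(v); together with M f(e_0) this bounds
    the rank of [M] by 2. *)
Lemma iso_line_similar : (2 < \rank N)%N ->
  lie_isomorphic (semidirect A) (coframe_lie alpha0) -> line_similar A N.
Proof.
move=> rN [f bf fL].
(* [g] is [f] with its values read as column vectors, on which [M] acts. *)
pose g (x : semidirect A) : 'cV[F]_(1 + n) := f x.
have gD x y : g (x + y) = g x + g y by rewrite /g linearD.
have gZ k x : g (k *: x) = k *: g x by rewrite /g linearZ.
have gL x y : g 'Lie[x, y] = g x 0 0 *: (M *m g y) - g y 0 0 *: (M *m g x).
  by rewrite /g fL.
case: bf => h fK hK.
have hK' y : g (h y) = y by exact: hK.
have g0 : g 0 = 0 by rewrite /g linear0.
pose e : semidirect A := (1, 0).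
pose i v : semidirect A := (0, v).
have dec x : x = x.1 *: e + i x.2.
  by case: x => s v; congr pair; rewrite /= ?addr0 ?scaler0 ?add0r // /GRing.scale /= mulr1.
have g00 v : g (i v) 0 0 = 0.
  apply/eqP/negPn/negP => nz.
  have gi w : M *m g (i w) = (g (i w) 0 0 / g (i v) 0 0) *: (M *m g (i v)).
    have := gL (i v) (i w).
    have -> : 'Lie[i v, i w] = 0 by rewrite semidirect_bracketE /= !scale0r subr0.
    rewrite g0 => /eqP; rewrite eq_sym subr_eq0 => /eqP E.
    by rewrite mulrC -scalerA -E scalerA mulVf // scale1r.
  (* M then maps everything into the span of M (f e_0) and M (f v). *)
  pose c1 : 'rV[F]_(1 + n) := \row_j (h (delta_mx j 0)).1.
  pose c2 : 'rV[F]_(1 + n) := \row_j (g (i (h (delta_mx j 0)).2) 0 0 / g (i v) 0 0).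
  have ME : M = (M *m g e) *m c1 + (M *m g (i v)) *m c2.
    apply/matrixP => a b.
    have /matrixP/(_ a 0) := colE b M; rewrite mxE => ->.
    rewrite -{1}[delta_mx b 0]hK' [h _]dec gD gZ mulmxDr gi -scalemxAr.
    set u := M *m g e; set w := M *m g (i v).
    rewrite !mxE !big_ord1 !mxE /=.
    by congr (_ + _); rewrite mulrC.
  suff : (\rank M <= 2)%N.
    have -> : \rank M = \rank (block_mx (0 : 'M_1) 0 0 N) by rewrite /M alphaN.
    by rewrite rank_diag_block_mx mxrank0 add0n leqNgt rN.
  rewrite ME; apply: leq_trans (mxrank_add _ _) _.
  exact: (leq_add (mulmx_max_rank _ _) (mulmx_max_rank _ _)).
(* The matrix of f on F^n; the f_0-row that it leaves out is zero by [g00]. *)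
pose P : 'M[F]_n := \matrix_(a, b) g (i (delta_mx b 0)) (rshift 1 a) 0.
have giE v : g (i v) = col_mx 0 (P *m v).
  have iD : {morph (g \o i) : u w / u + w}.
    move=> u w; rewrite /= -gD; congr g.
    by rewrite /i; congr pair; rewrite /= ?addr0.
  have iS : g (i v) = \sum_b v b 0 *: g (i (delta_mx b 0)).
    rewrite [v in LHS]matrix_sum_delta [LHS](big_morph _ iD g0).
    apply: eq_bigr => b _; rewrite big_ord1 /= -gZ; congr g.
    by rewrite /i; congr pair; rewrite /= scaler0.
  rewrite -[LHS]vsubmxK; congr col_mx; apply/matrixP => a b; rewrite !ord1.
    rewrite !mxE -[RHS](g00 v); congr (g _ _ _); exact/val_inj.
  rewrite !mxE iS summxE; apply: eq_bigr => c _.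
  by rewrite !mxE mulrC.
(* Otherwise all values of [g] would have f_0-coordinate 0, against surjectivity. *)
have te0 : g e 0 0 != 0.
  apply/eqP => ge0.
  have : (delta_mx 0 0 : 'cV[F]_(1 + n)) 0 0 = 0.
    by rewrite -[delta_mx 0 0]hK' [h _]dec gD gZ !mxE ge0 g00 mulr0 addr0.
  by rewrite mxE !eqxx => /eqP; rewrite oner_eq0.
exists (g e 0 0); exists P.
  split=> //; apply: unitmx_injective => v Pv0.
  have : g (i v) = g 0 by rewrite giE Pv0 col_mx0 g0.
  by move=> /(can_inj fK) /(congr1 snd).
apply/matrixP => a b.
have /matrixP/(_ a 0) := colE b (P *m A); rewrite mxE => ->.
have /matrixP/(_ a 0) := colE b (g e 0 0 *: (N *m P)); rewrite mxE => ->.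
set v := delta_mx b 0; rewrite -mulmxA -scalemxAl -mulmxA.
have := gL e (i v).
have -> : 'Lie[e, i v] = i (A *m v).
  by rewrite semidirect_bracketE /= scale1r mulmx0 scaler0 subr0.
rewrite g00 scale0r subr0 !giE forms_mulE -[RHS]/(_ *: col_mx _ _ : 'cV_(1 + n)).
by rewrite scale_col_mx => /eq_col_mx [_ ->].
Qed.
End CoframeIsomorphism.

(** * Normal forms *)

Section NormalForm.
Variable F : fieldType.

(* [Lmx v *m E4] (see [Lmx] below) has columns i v, j v, k v. *)
Definition E4 : 'M[F]_(4, 3) := \matrix_(i, j) (i == j.+1 :> nat)%:R.

(** The nilpotent part, when present, faces the first block; the classification meets this case only
    with [a1 = mu] and [b1 = 0]. *)
Definition normal_mx (mu : F) (nu : bool) (a1 b1 a2 b2 : F) : 'M[F]_(3 + (4 + 4)) :=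
  Amx mu (nu%:R *: col_mx E4 0) (B1mx a1 b1 a2 b2).

Local Arguments addn !_ _ /.
Local Notation f := (@dual F 11).

(** The twelve families are specializations of this single list, so the matrix of the coframe is
    computed once for all of them. *)
Definition normal_forms (mu : F) (nu : bool) (a1 b1 a2 b2 : F) : seq 'rV[F]_12 :=
  let n := nu%:R in
  [:: 0; mu *: f 1; mu *: f 2; mu *: f 3;
      a1 *: f 4 - b1 *: f 5; n *: f 1 + (b1 *: f 4 + a1 *: f 5);
      n *: f 2 + (a1 *: f 6 + b1 *: f 7); n *: f 3 + (- (b1 *: f 6) + a1 *: f 7);
      a2 *: f 8 - b2 *: f 9; b2 *: f 8 + a2 *: f 9;
      a2 *: f 10 + b2 *: f 11; - (b2 *: f 10) + a2 *: f 11].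

Lemma forms_mx_normal mu nu a1 b1 a2 b2 :
  forms_mx (normal_forms mu nu a1 b1 a2 b2)
    = block_mx (0 : 'M_1) 0 0 (normal_mx mu nu a1 b1 a2 b2) :> 'M_(1 + (3 + (4 + 4))).
Proof.
rewrite /normal_mx /Amx /B1mx scale_col_mx scaler0.
rewrite -[LHS](@submxK _ 1 _ 1 _); congr block_mx.
- by apply/matrixP => a b; rewrite !ord1 !mxE.
- by apply/matrixP => a b; rewrite !ord1 !mxE.
- apply/matrixP => -[a Ha] b; rewrite !ord1 !mxE /=.
  do 11! [case: a Ha => [|a] Ha; first by rewrite /= !mxE /= ?(mulr0, addr0, oppr0)].
  by [].
rewrite -[LHS](@submxK _ 3 _ 3 _); congr block_mx.
- apply/matrixP => -[a Ha] [b Hb]; rewrite !mxE /=.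
  by case: a Ha => [|[|[|a]]] Ha //; case: b Hb => [|[|[|b]]] Hb //;
    rewrite /= !mxE /= ?(mulr0, addr0, add0r, oppr0, mulr1, subr0) //.
- apply/matrixP => -[a Ha] [b Hb]; rewrite !mxE /=.
  by case: a Ha => [|[|[|a]]] Ha //; case: b Hb => [|[|[|[|[|[|[|[|b]]]]]]]] Hb //;
    rewrite /= !mxE /= ?(mulr0, addr0, add0r, oppr0, mulr1, subr0) //.
- rewrite -[LHS](@vsubmxK _ 4 4); congr col_mx;
  apply/matrixP => -[a Ha] [b Hb]; rewrite !mxE /=.
  by case: a Ha => [|[|[|[|a]]]] Ha //; case: b Hb => [|[|[|b]]] Hb //;
    rewrite /= !mxE /= ?(mulr0, addr0, add0r, oppr0, mulr1, subr0) //.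
  by case: a Ha => [|[|[|[|a]]]] Ha //; case: b Hb => [|[|[|b]]] Hb //;
    rewrite /= !mxE /= ?(mulr0, addr0, add0r, oppr0, mulr1, subr0) //.
by rewrite -[LHS](@submxK _ 4 4 4 4); congr block_mx;
  apply/matrixP => -[a Ha] [b Hb]; rewrite !mxE /=;
  case: a Ha => [|[|[|[|a]]]] Ha //; case: b Hb => [|[|[|[|b]]]] Hb //;
    rewrite /= !mxE /= ?(mulr0, addr0, add0r, oppr0, mulr1, subr0) //.
Qed.
End NormalForm.

(** * The quaternionic 4 x 4 blocks *)

Ltac mx4 :=
  apply/matrixP => -[[|[|[|[|?]]]] ?] // -[[|[|[|[|?]]]] ?] //;
  rewrite !mxE ?big_ord_recl ?big_ord0 /= ?mxE /=.

Section Blocks.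
Variable F : fieldType.

Lemma KmxZ (t a b : F) : t *: Kmx a b = Kmx (t * a) (t * b).
Proof. by mx4; ring. Qed.

Lemma Kmx_scalar (a : F) : Kmx a 0 = a%:M.
Proof. by mx4; ring. Qed.

Lemma Kmx_sub_scalar (m a b : F) : Kmx a b - m%:M = Kmx (a - m) b.
Proof. by mx4; ring. Qed.

(** [Kmx a b] is right multiplication by the quaternion a + b i in the basis 1, i, j, k; this is the
    norm identity, which provides its inverse. *)
Lemma Kmx_mul_conj (a b : F) : Kmx a b *m Kmx a (- b) = (a ^+ 2 + b ^+ 2)%:M.
Proof. by mx4; ring. Qed.

Definition swap01_23 : 'M[F]_4 :=
  \matrix_(i, j) (nth [::] [:: [:: 0; 1; 0; 0]; [:: 1; 0; 0; 0];
                               [:: 0; 0; 0; 1]; [:: 0; 0; 1; 0]] i)`_j.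

Lemma unitmx_swap01_23 : swap01_23 \in unitmx.
Proof.
by case: (@mulmx1_unit _ _ swap01_23 swap01_23) => //; mx4; ring.
Qed.

(** Exchanging 1 with i and j with k reverses the sign of b; this repairs the signs after rescaling
    by a negative number. *)
Lemma Kmx_opp_similar (a b : F) : swap01_23 *m Kmx a b = Kmx a (- b) *m swap01_23.
Proof. by mx4; ring. Qed.

(* The columns are v, i v, j v, k v for the quaternion v. *)
Definition Lmx (v : 'cV[F]_4) : 'M[F]_4 :=
  let x := v 0 0 in let y := v 1 0 in let z := v 2 0 in let t := v 3 0 in
  \matrix_(i, j) (nth [::] [:: [:: x; - y; - z; - t]; [:: y; x; t; - z];
                               [:: z; - t; x; y]; [:: t; z; - y; x]] i)`_j.

(** [Lmx v] is right multiplication by v, whose transpose is right multiplication by the conjugate.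
    Over an ordered field it is therefore invertible for v != 0. *)
Lemma Lmx_mul_tr v :
  (Lmx v)^T *m Lmx v = (v 0 0 ^+ 2 + v 1 0 ^+ 2 + v 2 0 ^+ 2 + v 3 0 ^+ 2)%:M.
Proof. by mx4; ring. Qed.

End Blocks.

(** * Conjugation to a normal form *)

Section Similarity.
Variable F : fieldType.

(** Conjugation by the lower triangular block matrix with diagonal [p], [Q] and corner [X]; the last
    hypothesis equates the lower left corners. *)
Lemma Amx_similar (m p : F) (V V' X : 'M_(4 + 4, 3)) (B B' Q : 'M[F]_(4 + 4)) :
  p != 0 -> Q \in unitmx -> Q *m B = B' *m Q -> m *: X + Q *m V = p *: V' + B' *m X ->
  line_similar (Amx m V B) (Amx m V' B').
Proof.
move=> p0 uQ eQ eX; apply: (@line_similar_conj _ _ _ _ (block_mx p%:M 0 X Q)).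
  by rewrite unitmxE det_lblock det_scalar unitrM -unitmxE uQ unitrX // unitfE.
rewrite /Amx !mulmx_block !mulmx0 !mul0mx !addr0 !add0r eQ -!scalar_mxM [m * p]mulrC.
by rewrite !scalar_mxC !mul_scalar_mx eX.
Qed.

Lemma block_swap_unit : block_mx 0 1%:M 1%:M 0 \in @unitmx F (4 + 4).
Proof.
case: (@mulmx1_unit _ _ (block_mx 0 1%:M 1%:M 0 : 'M[F]_(4 + 4)) (block_mx 0 1%:M 1%:M 0)) => //.
by rewrite mulmx_block !mulmx0 !mul0mx !mulmx1 !add0r !addr0 -scalar_mx_block.
Qed.

Lemma Amx_swap (m a1 b1 a2 b2 : F) V1 V2 :
  line_similar (Amx m (col_mx V1 V2) (B1mx a1 b1 a2 b2))
               (Amx m (col_mx V2 V1) (B1mx a2 b2 a1 b1)).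
Proof.
apply: (@Amx_similar _ 1 _ _ 0 _ _ _ (oner_neq0 _) block_swap_unit).
  by rewrite /B1mx !mulmx_block !mulmx0 !mul0mx !mul1mx !mulmx1 !add0r !addr0.
by rewrite mul_block_col !mul0mx !mul1mx mulmx0 scaler0 addr0 !add0r addr0 scale1r.
Qed.

Lemma normal_swap (m a1 b1 a2 b2 : F) :
  line_similar (normal_mx m false a1 b1 a2 b2) (normal_mx m false a2 b2 a1 b1).
Proof.
rewrite /normal_mx !scale0r.
by have := Amx_swap m a1 b1 a2 b2 0 0; rewrite !col_mx0.
Qed.

Lemma unitmx_diag_block n1 n2 (A : 'M[F]_n1) (B : 'M[F]_n2) :
  A \in unitmx -> B \in unitmx -> block_mx A 0 0 B \in unitmx.
Proof. by rewrite !unitmxE det_ublock unitrM => -> ->. Qed.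

End Similarity.

Section RealSimilarity.
Variable R : realFieldType.

Lemma Kmx_abs_similar (t a b : R) :
  exists2 Q, Q \in unitmx & Q *m Kmx (t * a) (t * b) = Kmx (t * a) (`|t| * b) *m Q.
Proof.
have [t0|t0] := leP 0 t.
  by exists 1%:M; rewrite ?unitmx1 // ger0_norm // mulmx1 mul1mx.
exists (swap01_23 R); first exact: unitmx_swap01_23.
by rewrite Kmx_opp_similar ltr0_norm // mulNr.
Qed.

(** A negative t reverses the signs of b_1 and b_2, and each half is conjugated back separately. The
    nilpotent part survives this because [b1 = 0] allows the first half to be left alone. *)
Lemma normal_scale (t m : R) (nu : bool) (a1 b1 a2 b2 : R) :
  t != 0 -> (nu -> b1 = 0) ->
  line_similar (normal_mx m nu a1 b1 a2 b2)
               (normal_mx (t * m) nu (t * a1) (`|t| * b1) (t * a2) (`|t| * b2)).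
Proof.
move=> t0 nub; apply: line_similar_trans (line_similarZ _ t0) _.
have [Q1 [uQ1 eQ1 nuQ]] : exists Q, [/\ Q \in unitmx,
    Q *m Kmx (t * a1) (t * b1) = Kmx (t * a1) (`|t| * b1) *m Q & nu -> Q = 1%:M].
  case: nu nub => [->|_] //; last by case: (Kmx_abs_similar t a1 b1) => Q; exists Q.
  by exists 1%:M; rewrite unitmx1 !mulr0 mulmx1 mul1mx.
have [Q2 uQ2 eQ2] := Kmx_abs_similar t a2 b2.
rewrite {1}/normal_mx /Amx /B1mx !scale_block_mx scale_scalar_mx !scaler0 !KmxZ.
(* Taking [p = t] absorbs the factor t that the nilpotent part has acquired. *)
apply: (@Amx_similar _ _ t _ _ 0 _ _ (block_mx Q1 0 0 Q2)) => //.
- exact: unitmx_diag_block.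
- by rewrite !mulmx_block !mulmx0 !mul0mx !addr0 !add0r eQ1 eQ2.
rewrite scaler0 add0r mulmx0 addr0 -!scalemxAr; congr (_ *: _).
case: nu nuQ {nub} => [->|] //; last by rewrite !scale0r.
by rewrite !scale1r mul_block_col !mulmx0 !mul0mx mul1mx !addr0.
Qed.

Lemma unitmx_Kmx (a b : R) : (a != 0) || (b != 0) -> Kmx a b \in unitmx.
Proof.
move=> ab0; have q0 : a ^+ 2 + b ^+ 2 != 0.
  by rewrite paddr_eq0 ?sqr_ge0 // !sqrf_eq0 negb_and.
have : Kmx a b *m ((a ^+ 2 + b ^+ 2)^-1 *: Kmx a (- b)) = 1%:M.
  by rewrite -scalemxAr Kmx_mul_conj scale_scalar_mx mulVf.
by case/mulmx1_unit.
Qed.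

Lemma unitmx_Lmx (v : 'cV[R]_4) : v != 0 -> Lmx v \in unitmx.
Proof.
move=> v0; set q := v 0 0 ^+ 2 + v 1 0 ^+ 2 + v 2 0 ^+ 2 + v 3 0 ^+ 2.
have q0 : q != 0.
  apply: contraNneq v0 => /eqP.
  rewrite !paddr_eq0 ?addr_ge0 ?sqr_ge0 // !sqrf_eq0 => /andP[/andP[/andP[]]].
  move=> /eqP e0 /eqP e1 /eqP e2 /eqP e3; apply/eqP/matrixP => -[i Hi] j; rewrite ord1 mxE.
  case: i Hi => [|[|[|[|i]]]] Hi //.
  - by rewrite -[RHS]e0; congr (v _ _); apply/val_inj.
  - by rewrite -[RHS]e1; congr (v _ _); apply/val_inj.
  - by rewrite -[RHS]e2; congr (v _ _); apply/val_inj.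
  - by rewrite -[RHS]e3; congr (v _ _); apply/val_inj.
have : (q^-1 *: (Lmx v)^T) *m Lmx v = 1%:M.
  by rewrite -scalemxAl Lmx_mul_tr scale_scalar_mx mulVf.
by case/mulmx1_unit.
Qed.

(** The equation reads (K(a, b) - m) X = [Lmx v *m E4], and K(a, b) - m = K(a - m, b) is invertible
    unless it is zero. *)
Lemma block_solvable (m a b : R) (v : 'cV[R]_4) :
  (exists X : 'M_(4, 3), m *: X + Lmx v *m E4 R = Kmx a b *m X) \/
  [/\ a = m, b = 0 & Lmx v \in unitmx].
Proof.
have [-> | v0] := eqVneq v 0.
  left; exists 0; rewrite mulmx0 scaler0 add0r.
  have -> : Lmx (0 : 'cV[R]_4) = 0 by mx4; rewrite ?oppr0.
  by rewrite mul0mx.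
have [am | am] := eqVneq a m; last first.
  left; have uK : Kmx (a - m) b \in unitmx by rewrite unitmx_Kmx // subr_eq0 am.
  exists (invmx (Kmx (a - m) b) *m (Lmx v *m E4 R)).
  by rewrite -[Kmx a b](subrK m%:M) Kmx_sub_scalar mulmxDl mulKVmx // mul_scalar_mx addrC.
have [b0 | b0] := eqVneq b 0; first by right; split=> //; apply: unitmx_Lmx.
left; have uK : Kmx (a - m) b \in unitmx by rewrite unitmx_Kmx // b0 orbT.
exists (invmx (Kmx (a - m) b) *m (Lmx v *m E4 R)).
by rewrite -[Kmx a b](subrK m%:M) Kmx_sub_scalar mulmxDl mulKVmx // mul_scalar_mx addrC.
Qed.

(** The first block is scalar, hence commutes with [invmx (Lmx v1)], which turns [Lmx v1 *m E4] into
    [E4]. The second half is cleared by a corner [X] if its equation is solvable. *)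
Lemma Amx_normal_left (m b1 a2 b2 : R) v1 v2 : b1 = 0 -> Lmx v1 \in unitmx ->
  line_similar (Amx m (col_mx (Lmx v1 *m E4 R) (Lmx v2 *m E4 R)) (B1mx m b1 a2 b2))
               (normal_mx m true m 0 a2 b2).
Proof.
move=> -> uL; rewrite /normal_mx scale1r.
case: (block_solvable m a2 b2 v2) => [[X eX] | [-> -> uL2]].
  apply: (@Amx_similar _ _ 1 _ _ (col_mx 0 X) _ _ (block_mx (invmx (Lmx v1)) 0 0 1%:M)).
  - exact: oner_neq0.
  - by rewrite unitmx_diag_block ?unitmx_inv ?unitmx1.
  - by rewrite /B1mx Kmx_scalar !mulmx_block !mulmx0 !mul0mx !addr0 !add0r mul1mx mulmx1 scalar_mxC.
  rewrite /B1mx !mul_block_col !mul0mx mul1mx !mulmx0 !addr0 !add0r mulKmx // scale1r.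
  by rewrite scale_col_mx !add_col_mx scaler0 add0r eX addr0 add0r.
(* Both blocks are now m I, so [Q] may mix the halves: it clears the second one by subtracting a
   multiple of the first. *)
apply: (@Amx_similar _ _ 1 _ _ 0 _ _
          (block_mx (invmx (Lmx v1)) 0 (- (Lmx v2 *m invmx (Lmx v1))) 1%:M)).
- exact: oner_neq0.
- by rewrite unitmxE det_lblock det1 mulr1 -unitmxE unitmx_inv.
- by rewrite /B1mx Kmx_scalar -scalar_mx_block scalar_mxC.
rewrite scaler0 mulmx0 add0r addr0 scale1r mul_block_col mul0mx addr0 mulKmx // mul1mx.
by rewrite mulNmx -mulmxA mulKmx // addNr.
Qed.

(** A half with unsolvable equation keeps its nilpotent part. If this happens in the second half
    only, the halves are exchanged first, which is why the last alternative has [a1], [b1] in its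
    second block. *)
Lemma Amx_normal (m a1 b1 a2 b2 : R) v1 v2
    (A := Amx m (col_mx (Lmx v1 *m E4 R) (Lmx v2 *m E4 R)) (B1mx a1 b1 a2 b2)) :
  [\/ line_similar A (normal_mx m false a1 b1 a2 b2),
      line_similar A (normal_mx m true m 0 a2 b2)
    | line_similar A (normal_mx m true m 0 a1 b1)].
Proof.
rewrite /A.
case: (block_solvable m a1 b1 v1) => [[X1 e1] | [-> b10 u1]]; last first.
  by constructor 2; apply: Amx_normal_left.
case: (block_solvable m a2 b2 v2) => [[X2 e2] | [-> b20 u2]]; last first.
  constructor 3; apply: line_similar_trans (Amx_swap _ _ _ _ _ _ _) _.
  exact: Amx_normal_left.
constructor 1; rewrite /normal_mx scale0r.
apply: (@Amx_similar _ _ 1 _ _ (col_mx X1 X2) _ _ 1%:M); rewrite ?oner_neq0 ?unitmx1 //.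
  by rewrite mulmx1 mul1mx.
by rewrite /B1mx scaler0 add0r mul_block_col !mul0mx addr0 add0r mul1mx scale_col_mx add_col_mx e1 e2.
Qed.

End RealSimilarity.

(** * The quaternionic action *)

Section Quaternionic.
Variable F : fieldType.
Variables (n : nat) (I : 'I_3 -> 'M[F]_n).
Hypotheses (I_sq : forall k, I k *m I k = - 1%:M)
  (I01 : I 0 *m I 1 = I 2) (I10 : I 1 *m I 0 = - I 2).

(** The relations determine all products: the [I k] act on the [e i] as left multiplication by i, j,
    k acts on 1, i, j, k. *)
Lemma quaternion_table (e : 'I_4 -> 'cV[F]_n) :
  (forall k, I k *m e ord0 = e (lift ord0 k)) ->
  [/\ [/\ I 0 *m e 0 = e 1, I 0 *m e 1 = - e 0, I 0 *m e 2 = e 3 & I 0 *m e 3 = - e 2],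
      [/\ I 1 *m e 0 = e 2, I 1 *m e 1 = - e 3, I 1 *m e 2 = - e 0 & I 1 *m e 3 = e 1]
    & [/\ I 2 *m e 0 = e 3, I 2 *m e 1 = e 2, I 2 *m e 2 = - e 1 & I 2 *m e 3 = - e 0]].
Proof.
move=> h.
have h0 : I 0 *m e 0 = e 1.
  by rewrite -[e 0]/(e ord0) h; congr e; apply/val_inj.
have h1 : I 1 *m e 0 = e 2.
  by rewrite -[e 0]/(e ord0) h; congr e; apply/val_inj.
have h2 : I 2 *m e 0 = e 3.
  by rewrite -[e 0]/(e ord0) h; congr e; apply/val_inj.
have sq k v : I k *m (I k *m v) = - v :> 'cV_n by rewrite mulmxA I_sq mulNmx mul1mx.
have p01 v : I 0 *m (I 1 *m v) = I 2 *m v :> 'cV_n by rewrite mulmxA I01.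
have p10 v : I 1 *m (I 0 *m v) = - (I 2 *m v) :> 'cV_n by rewrite mulmxA I10 mulNmx.
have p02 v : I 0 *m (I 2 *m v) = - (I 1 *m v) :> 'cV_n by rewrite -p01 sq.
have p20 v : I 2 *m (I 0 *m v) = I 1 *m v :> 'cV_n.
  by rewrite -[LHS]opprK -p10 sq mulmxN opprK.
have p12 v : I 1 *m (I 2 *m v) = I 0 *m v :> 'cV_n.
  by rewrite -[I 2 *m v]opprK -p10 mulmxN sq opprK.
have p21 v : I 2 *m (I 1 *m v) = - (I 0 *m v) :> 'cV_n by rewrite -p01 sq mulmxN.
split; split=> //.
- by rewrite -h0 sq.
- by rewrite -h1 p01.
- by rewrite -h2 p02 h1.
- by rewrite -h0 p10 h2.
- by rewrite -h1 sq.
- by rewrite -h2 p12.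
- by rewrite -h0 p20.
- by rewrite -h1 p21 h0.
- by rewrite -h2 sq.
Qed.

End Quaternionic.

(** The bases u and w identify F^8 with two copies of the quaternions on which the [I k] are left
    multiplications, so each half of V has columns i v, j v, k v. *)
Lemma quaternionic_columnsE (F : fieldType) (I : 'I_3 -> 'M[F]_(4 + 4))
    (V : 'M_(4 + 4, 3)) (v : 'cV_(4 + 4)) :
  (forall k, I k *m I k = - 1%:M) -> I 0 *m I 1 = I 2 -> I 1 *m I 0 = - I 2 ->
  (forall k, I k *m u_ F ord0 = u_ F (lift ord0 k)) ->
  (forall k, I k *m w_ F ord0 = w_ F (lift ord0 k)) ->
  (forall k, col k V = I k *m v) ->
  V = col_mx (Lmx (usubmx v) *m E4 F) (Lmx (dsubmx v) *m E4 F).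
Proof.
move=> I_sq I01 I10 Iu Iw colV.
have vE : v = \sum_i usubmx v i 0 *: u_ F i + \sum_i dsubmx v i 0 *: w_ F i.
  rewrite [v in LHS]matrix_sum_delta big_split_ord /=.
  by congr (_ + _); apply: eq_bigr => i _; rewrite big_ord1 mxE.
have [[u00 u01 u02 u03] [u10 u11 u12 u13] [u20 u21 u22 u23]] :=
  quaternion_table I_sq I01 I10 Iu.
have [[w00 w01 w02 w03] [w10 w11 w12 w13] [w20 w21 w22 w23]] :=
  quaternion_table I_sq I01 I10 Iw.
have sum4 (G : 'I_4 -> 'cV[F]_(4 + 4)) : \sum_i G i = G 0 + G 1 + G 2 + G 3.
  rewrite !big_ord_recl big_ord0 addr0 !addrA.
  by do ![congr (_ + _)]; congr G; apply/val_inj.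
have IvE k : I k *m v =
    usubmx v 0 0 *: (I k *m u_ F 0) + usubmx v 1 0 *: (I k *m u_ F 1)
    + usubmx v 2 0 *: (I k *m u_ F 2) + usubmx v 3 0 *: (I k *m u_ F 3)
  + (dsubmx v 0 0 *: (I k *m w_ F 0) + dsubmx v 1 0 *: (I k *m w_ F 1)
    + dsubmx v 2 0 *: (I k *m w_ F 2) + dsubmx v 3 0 *: (I k *m w_ F 3)).
  by rewrite [v in LHS]vE !sum4 !mulmxDr -!scalemxAr.
have Vcol k (i : 'I_(4 + 4)) : V i k = (I k *m v) i 0 by rewrite -colV mxE.
move: {vE colV} (usubmx v) (dsubmx v) IvE => x y IvE.
rewrite -[LHS]vsubmxK; congr col_mx; apply/matrixP => i k; rewrite mxE Vcol IvE.
- case: k => [[|[|[|k]]] Hk] //.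
  + rewrite (_ : Ordinal Hk = 0) ?u00 ?u01 ?u02 ?u03 ?w00 ?w01 ?w02 ?w03; last exact/val_inj.
    by case: i => [[|[|[|[|i]]]] Hi] //; rewrite !mxE !big_ord_recl big_ord0 !mxE /=; ring.
  + rewrite (_ : Ordinal Hk = 1) ?u10 ?u11 ?u12 ?u13 ?w10 ?w11 ?w12 ?w13; last exact/val_inj.
    by case: i => [[|[|[|[|i]]]] Hi] //; rewrite !mxE !big_ord_recl big_ord0 !mxE /=; ring.
  rewrite (_ : Ordinal Hk = 2) ?u20 ?u21 ?u22 ?u23 ?w20 ?w21 ?w22 ?w23; last exact/val_inj.
  by case: i => [[|[|[|[|i]]]] Hi] //; rewrite !mxE !big_ord_recl big_ord0 !mxE /=; ring.
case: k => [[|[|[|k]]] Hk] //.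
+ rewrite (_ : Ordinal Hk = 0) ?u00 ?u01 ?u02 ?u03 ?w00 ?w01 ?w02 ?w03; last exact/val_inj.
  by case: i => [[|[|[|[|i]]]] Hi] //; rewrite !mxE !big_ord_recl big_ord0 !mxE /=; ring.
+ rewrite (_ : Ordinal Hk = 1) ?u10 ?u11 ?u12 ?u13 ?w10 ?w11 ?w12 ?w13; last exact/val_inj.
  by case: i => [[|[|[|[|i]]]] Hi] //; rewrite !mxE !big_ord_recl big_ord0 !mxE /=; ring.
rewrite (_ : Ordinal Hk = 2) ?u20 ?u21 ?u22 ?u23 ?w20 ?w21 ?w22 ?w23; last exact/val_inj.
by case: i => [[|[|[|[|i]]]] Hi] //; rewrite !mxE !big_ord_recl big_ord0 !mxE /=; ring.
Qed.

(** * Ranks *)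

Section Rank.
Variable F : fieldType.

Lemma mxrank_sandwich m n p q (P : 'M[F]_(p, m)) (M : 'M_(m, n)) (Q : 'M_(n, q)) :
  (\rank (P *m M *m Q) <= \rank M)%N.
Proof. exact: leq_trans (mxrankM_maxl _ _) (mxrankM_maxr _ _). Qed.

Lemma tr_E4_mul : (E4 F)^T *m E4 F = 1%:M.
Proof.
by apply/matrixP => -[[|[|[|?]]] ?] // -[[|[|[|?]]] ?] //;
  rewrite !mxE !big_ord_recl big_ord0 !mxE /=; ring.
Qed.

Lemma rank_E4 : \rank (E4 F) = 3%N.
Proof.
apply/anti_leq; rewrite rank_leq_col -{1}(mxrank1 F 3) -tr_E4_mul.
exact: mxrankM_maxr.
Qed.

Lemma rank_E4_mul_tr : \rank (E4 F *m (E4 F)^T) = 3%N.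
Proof.
apply/anti_leq/andP; split.
  by apply: leq_trans (mxrankM_maxl _ _) _; rewrite rank_E4.
rewrite -{1}rank_E4 -[X in \rank X]mulmx1 -tr_E4_mul mulmxA.
exact: mxrankM_maxl.
Qed.

(** A block is cut out by multiplying with coordinate inclusions on both sides, which cannot raise
    the rank. *)
Lemma rank_block_ge m1 m2 n1 n2 (A : 'M[F]_(m1, n1)) (B : 'M_(m1, n2)) C (D : 'M_(m2, n2)) :
  [/\ \rank A <= \rank (block_mx A B C D),
      \rank C <= \rank (block_mx A B C D) &
      \rank D <= \rank (block_mx A B C D)]%N.
Proof.
by split; [have := mxrank_sandwich (row_mx 1%:M 0) (block_mx A B C D) (col_mx 1%:M 0)
         | have := mxrank_sandwich (row_mx 0 1%:M) (block_mx A B C D) (col_mx 1%:M 0)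
         | have := mxrank_sandwich (row_mx 0 1%:M) (block_mx A B C D) (col_mx 0 1%:M)];
  rewrite mul_row_block mul_row_col !mul1mx !mul0mx !mulmx0 !mulmx1 ?addr0 ?add0r.
Qed.

Lemma normal_mx_sub_scalar (m : F) nu a1 b1 a2 b2 :
  normal_mx m nu a1 b1 a2 b2 - m%:M = normal_mx 0 nu (a1 - m) b1 (a2 - m) b2.
Proof.
rewrite /normal_mx /Amx /B1mx !scalar_mx_block !opp_block_mx !add_block_mx !oppr0 !addr0.
by rewrite !Kmx_sub_scalar subrr raddf0.
Qed.

End Rank.

Section RealRank.
Variable R : realFieldType.

Lemma rank_Kmx (a b : R) : \rank (Kmx a b) = (4 * ((a != 0%R) || (b != 0%R)))%N.
Proof.
have [ab0|] := boolP ((a != 0) || (b != 0)); first exact/mxrank_unit/unitmx_Kmx.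
rewrite negb_or !negbK => /andP[/eqP-> /eqP->]; rewrite Kmx_scalar.
by rewrite raddf0 mxrank0.
Qed.

(** This secures the rank hypothesis of [iso_line_similar]: one nonzero parameter already produces a
    block of rank 3 or 4. *)
Lemma rank_normal_lb (m : R) (nu : bool) (a1 b1 a2 b2 : R) :
  [|| m != 0, nu, a1 != 0, b1 != 0, a2 != 0 | b2 != 0] ->
  (2 < \rank (normal_mx m nu a1 b1 a2 b2))%N.
Proof.
have [rm rnu rB] := rank_block_ge m%:M 0 (nu%:R *: col_mx (E4 R) 0 : 'M_(4 + 4, 3))
  (B1mx a1 b1 a2 b2).
case/or3P => [m0 | nu1 | ab0].
- by apply: leq_trans rm; rewrite mxrank_unit // unitmxE det_scalar unitrX // unitfE.
- by apply: leq_trans rnu; rewrite nu1 scale1r rank_col_mx0 rank_E4.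
apply: leq_trans rB; rewrite rank_diag_block_mx !rank_Kmx.
by move: ab0; rewrite orbA; case: (_ || (b1 != 0)); case: (_ || (b2 != 0)).
Qed.

(** When [nu] holds, the first block vanishes, so [E4] has its four rows to itself and the ranks add
    up. *)
Lemma rank_normal_mu0 (nu : bool) (a1 b1 a2 b2 : R) :
  (nu -> a1 = 0 /\ b1 = 0) ->
  \rank (normal_mx 0 nu a1 b1 a2 b2) = (3 * nu + \rank (Kmx a1 b1) + \rank (Kmx a2 b2))%N.
Proof.
case: nu => [[//|-> ->]|_]; last first.
  by rewrite /normal_mx scale0r !rank_diag_block_mx raddf0 mxrank0 muln0.
rewrite Kmx_scalar raddf0 mxrank0 addn0.
(* E4 E4^T is the coordinate projection onto i, j, k; being square of rank 3, it makes [G] block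
   diagonal. *)
pose G := block_mx (E4 R *m (E4 R)^T) 0 0 (Kmx a2 b2).
have rG : \rank G = (3 + \rank (Kmx a2 b2))%N by rewrite rank_diag_block_mx rank_E4_mul_tr.
rewrite -rG /normal_mx scale1r /Amx /B1mx Kmx_scalar !raddf0.
(* N and G factor through each other because E4^T E4 = 1. *)
pose U : 'M[R]_(3 + (4 + 4), 4 + 4) := col_mx 0 1%:M.
pose W : 'M[R]_(4 + 4, 3 + (4 + 4)) := row_mx (col_mx (E4 R) 0) (block_mx 0 0 0 1%:M).
pose W' : 'M[R]_(3 + (4 + 4), 4 + 4) := col_mx (row_mx (E4 R)^T 0) (block_mx 0 0 0 1%:M).
set N := block_mx _ _ _ _.
have eN : N = U *m G *m W.
  rewrite mul_col_mx mul0mx mul1mx mul_col_row !mul0mx /G mul_block_col !mulmx0 !mul0mx.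
  rewrite !addr0 -mulmxA tr_E4_mul mulmx1 mulmx_block !mulmx0 !mul0mx !addr0 mulmx1 add0r.
  by [].
have eG : G = U^T *m N *m W'.
  rewrite tr_col_mx trmx0 trmx1 mul_row_block !mul0mx !add0r !mul1mx mul_row_col.
  rewrite mul_col_row !mul0mx !mulmx0 mulmx_block !mulmx0 !mul0mx !add0r mulmx1 add_block_mx.
  by rewrite !addr0 add0r.
by apply/anti_leq/andP; split; [rewrite eN | rewrite {1}eG]; apply: mxrank_sandwich.
Qed.

End RealRank.

(** * Every normal form is in the list *)

Section Labels.
Variable R : realFieldType.

Definition label_params (l : label R) : R * bool * (R * R) * (R * R) :=
  match l with
  | S1 a c d => (0, false, (a, 1), (c, d))
  | S2 a c => (0, false, (a, 1), (c, 1))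
  | S3 a b c d => (1, false, (a, b), (c, d))
  | S4 a b c => (1, false, (a, b), (c, b))
  | S5 a c => (0, false, (a, 0), (c, 1))
  | S6 c => (0, true, (0, 0), (c, 1))
  | S7 a c d => (1, false, (a, 0), (c, d))
  | S8 c d => (1, true, (1, 0), (c, d))
  | S9 c => (0, false, (1, 0), (c, 0))
  | S10 c => (0, true, (0, 0), (c, 0))
  | S11 a c => (1, false, (a, 0), (c, 0))
  | S12 c => (1, true, (1, 0), (c, 0))
  end.

Definition label_mx (l : label R) : 'M[R]_(3 + (4 + 4)) :=
  let: (m, nu, (a1, b1), (a2, b2)) := label_params l in normal_mx m nu a1 b1 a2 b2.

(** The ambiguity left by line similarity: a factor t, acting on the b_i through |t| since they are
    kept nonnegative, and the order of the two blocks. *)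
Definition label_params_rescale (t : R) (l l' : label R) : Prop :=
  let: (m, nu, (a1, b1), (a2, b2)) := label_params l in
  let: (m', nu', (a1', b1'), (a2', b2')) := label_params l' in
  [/\ t != 0, m = t * m', nu = nu' &
     [/\ a1 = t * a1', b1 = `|t| * b1', a2 = t * a2' & b2 = `|t| * b2'] \/
     [/\ a1 = t * a2', b1 = `|t| * b2', a2 = t * a1' & b2 = `|t| * b1']].

Lemma s_coframe (l : label R) : exists alpha alpha0,
  s_ l = @coframe_lie R 11 alpha alpha0 /\
  forms_mx alpha = block_mx (0 : 'M_1) 0 0 (label_mx l) :> 'M_(1 + (3 + (4 + 4))).
Proof.
by case: l => *; (do 2!eexists; split; first by reflexivity); rewrite -forms_mx_normal;
  congr forms_mx; rewrite /normal_forms !(scale0r, scale1r, add0r, addr0, subr0, oppr0).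
Qed.

Lemma label_mx_rank (l : label R) : admissible l -> (2 < \rank (label_mx l))%N.
Proof.
by case: l => * /=; apply: rank_normal_lb; rewrite ?oner_neq0 ?orbT.
Qed.

(** Existence and uniqueness both become statements about matrices here; the rank bound
    [label_mx_rank] lets an isomorphism yield a similarity. *)
Lemma iso_s_iff A (l : label R) : admissible l ->
  lie_isomorphic (semidirect A) (s_ l) <-> line_similar A (label_mx l).
Proof.
move=> adm; have [alpha [alpha0 [-> e]]] := s_coframe l.
split; last exact: (line_similar_iso alpha0 e).
exact: (iso_line_similar e (label_mx_rank adm)).
Qed.

Definition has_label (m : R) (nu : bool) (a1 b1 a2 b2 : R) : Prop :=
  exists2 l, admissible l & line_similar (normal_mx m nu a1 b1 a2 b2) (label_mx l).

Lemma has_label_swap m (a1 b1 a2 b2 : R) :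
  has_label m false a2 b2 a1 b1 -> has_label m false a1 b1 a2 b2.
Proof.
by case=> l adm s; exists l => //; apply: line_similar_trans (normal_swap _ _ _ _ _) s.
Qed.

Lemma has_label_scale (t m : R) (nu : bool) (a1 b1 a2 b2 : R) : t != 0 -> (nu -> b1 = 0) ->
  has_label (t * m) nu (t * a1) (`|t| * b1) (t * a2) (`|t| * b2) ->
  has_label m nu a1 b1 a2 b2.
Proof.
move=> t0 nub [l adm s]; exists l => //.
by apply: line_similar_trans s; apply: normal_scale.
Qed.

Lemma has_label_mx (l : label R) : admissible l ->
  exists2 l', admissible l' & line_similar (label_mx l) (label_mx l').
Proof. by exists l => //; exact: line_similar_refl. Qed.

(** Exchanging the blocks arranges |a| <= |c|, and the factor -1 then makes c nonnegative. *)
Lemma has_label_S2 (a c : R) : has_label 0 false a 1 c 1.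
Proof.
wlog ac : a c / `|a| <= `|c|.
  move=> H; have [|/ltW] := leP `|a| `|c|; first exact: H.
  by move=> ca; apply: has_label_swap; apply: H.
wlog c0 : a c ac / 0 <= c.
  move=> H; have [|/ltW c0] := leP 0 c; first exact: H.
  apply: (@has_label_scale (-1)) => //; first by rewrite oppr_eq0 oner_neq0.
  rewrite normrN1 !mul1r mulr0 !mulN1r; apply: H; last by rewrite oppr_ge0.
  by rewrite !normrN.
apply: (@has_label_mx (S2 a c)) => /=.
have [a0|a0] := leP 0 a.
  by left; move: ac; rewrite !ger0_norm // => ->; rewrite a0.
(* Here a < 0, so c = 0 would contradict |a| <= |c|. *)
right; split=> //; rewrite lt_neqAle c0 andbT; apply: contraTneq ac => <-.
by rewrite normr0 -ltNge normr_gt0 lt_eqF.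
Qed.

(** The smallest nonzero b_i is scaled to 1, which leads to [S1], [S2] or [S5]. If both b_i vanish,
    the a_i of larger absolute value is scaled to 1 instead, which leads to [S9]. *)
Lemma has_label_mu0 (a1 b1 a2 b2 : R) : 0 <= b1 -> 0 <= b2 ->
  [|| a1 != 0, b1 != 0, a2 != 0 | b2 != 0] -> has_label 0 false a1 b1 a2 b2.
Proof.
wlog b12 : a1 b1 a2 b2 / b1 <= b2.
  move=> H h1 h2 nz; have [|/ltW] := leP b1 b2; first by move=> ?; apply: H.
  move=> b21; apply: has_label_swap; apply: H => //.
  by move: nz; do 4!case: eqP => //.
move=> b10 b20.
have [b1_0|b1_n0 _] := eqVneq b1 0; last first.
  have b1_gt0 : 0 < b1 by rewrite lt_def b1_n0.
  apply: (@has_label_scale b1^-1); rewrite ?invr_neq0 //.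
  rewrite mulr0 gtr0_norm ?invr_gt0 // mulVf //.
  have [b12_lt|] := ltP b1 b2.
    apply: (@has_label_mx (S1 _ _ _)) => /=.
    by rewrite mulrC ltr_pdivlMr // mul1r.
  move=> b21; have -> : b2 = b1 by apply/le_anti/andP.
  by rewrite mulVf //; apply: has_label_S2.
rewrite b1_0; have [b2_0|b2_n0 _] := eqVneq b2 0; last first.
  have b2_gt0 : 0 < b2 by rewrite lt_def b2_n0.
  apply: (@has_label_scale b2^-1); rewrite ?invr_neq0 //.
  rewrite !mulr0 gtr0_norm ?invr_gt0 // mulVf //.
  set a := _ * a1; set c := _ * a2.
  have [a0|a0] := eqVneq a 0; last by apply: (@has_label_mx (S5 _ _)); left.
  have [c0|c0] := leP 0 c; first by apply: (@has_label_mx (S5 _ _)); right.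
  apply: (@has_label_scale (-1)); rewrite ?oppr_eq0 ?oner_neq0 //.
  rewrite normrN1 !mulr0 mulr1 !mulN1r.
  by apply: (@has_label_mx (S5 _ _)); right; rewrite a0 oppr0 oppr_ge0 ltW.
rewrite b2_0 /= !orbF => nz {b12 b10 b20 b1_0 b2_0}.
wlog a21 : a1 a2 nz / `|a2| <= `|a1|.
  move=> H; have [|/ltW] := leP `|a2| `|a1|; first exact: H.
  by move=> a12; apply: has_label_swap; apply: H; rewrite // orbC.
have a10 : a1 != 0.
  apply: contraTneq nz => a10; move: a21; rewrite a10 normr0 normr_le0 => /eqP->.
  by rewrite eqxx.
apply: (@has_label_scale a1^-1); rewrite ?invr_neq0 // !mulr0 mulVf //.
apply: (@has_label_mx (S9 _)) => /=.
by rewrite normrM normfV mulrC ler_pdivrMr ?normr_gt0 // mul1r.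
Qed.

(** The scale is spent on mu = 1, and only the order of the blocks is left: it sorts the b_i if they
    differ ([S3], [S7]) and the a_i otherwise ([S4], [S11]). *)
Lemma has_label_mu_neq0 m (a1 b1 a2 b2 : R) : m != 0 -> 0 <= b1 -> 0 <= b2 ->
  has_label m false a1 b1 a2 b2.
Proof.
move=> m0 b10 b20; apply: (@has_label_scale m^-1); rewrite ?invr_neq0 // mulVf //.
have := mulr_ge0 (normr_ge0 m^-1) b20; have := mulr_ge0 (normr_ge0 m^-1) b10.
move: (_ * a1) (_ * b1) (_ * a2) (_ * b2) => {m0 b10 b20 a1 b1 a2 b2} a1 b1 a2 b2.
wlog b12 : a1 b1 a2 b2 / b1 <= b2.
  move=> H h1 h2; have [|/ltW] := leP b1 b2; first by move=> ?; apply: H.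
  by move=> b21; apply: has_label_swap; apply: H.
move=> b10 b20.
have [b12_lt|b21] := ltP b1 b2.
  have [b1_0|b1_n0] := eqVneq b1 0.
    by rewrite b1_0; apply: (@has_label_mx (S7 _ _ _)); rewrite /= -b1_0.
  by apply: (@has_label_mx (S3 _ _ _ _)); rewrite /= b12_lt andbT lt_def b1_n0.
have -> : b2 = b1 by apply/le_anti/andP.
wlog a12 : a1 a2 / a1 <= a2.
  move=> H; have [|/ltW] := leP a1 a2; first exact: H.
  by move=> a21; apply: has_label_swap; apply: H.
have [b1_0|b1_n0] := eqVneq b1 0.
  by rewrite b1_0; apply: (@has_label_mx (S11 _ _)).
by apply: (@has_label_mx (S4 _ _ _)); rewrite /= a12 lt_def b1_n0.
Qed.

(** For m != 0 the scale is spent on m = 1 ([S8], [S12]). For m = 0 it normalizes the second block: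
    to b = 1 and a >= 0 ([S6]), or, when b = 0, to a = 0 or 1 ([S10]). *)
Lemma has_label_nilpotent m (a b : R) : 0 <= b -> has_label m true m 0 a b.
Proof.
move=> b0; have [->|m0] := eqVneq m 0; last first.
  apply: (@has_label_scale m^-1); rewrite ?invr_neq0 // mulVf // mulr0.
  have [->|b_n0] := eqVneq b 0.
    by rewrite mulr0; apply: (@has_label_mx (S12 _)).
  apply: (@has_label_mx (S8 _ _)).
  by rewrite /= mulr_gt0 ?normr_gt0 ?invr_neq0 // lt_def b_n0.
have [->|b_n0] := eqVneq b 0.
  have [->|a0] := eqVneq a 0; first by apply: (@has_label_mx (S10 0)); left.
  apply: (@has_label_scale a^-1); rewrite ?invr_neq0 // !mulr0 mulVf //.
  by apply: (@has_label_mx (S10 1)); right.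
have b_gt0 : 0 < b by rewrite lt_def b_n0.
wlog a0 : a / 0 <= a.
  move=> H; have [|/ltW a0] := leP 0 a; first exact: H.
  apply: (@has_label_scale (-1)); rewrite ?oppr_eq0 ?oner_neq0 //.
  by rewrite normrN1 !mulr0 mul1r mulN1r; apply: H; rewrite oppr_ge0.
apply: (@has_label_scale b^-1); rewrite ?invr_neq0 // !mulr0 gtr0_norm ?invr_gt0 //.
rewrite mulVf //; apply: (@has_label_mx (S6 _)).
by rewrite /= mulr_ge0 // invr_ge0.
Qed.

End Labels.

(** * Characteristic polynomials *)

Section CharPoly.
Variable F : fieldType.

Lemma char_poly_lblock m n (A : 'M[F]_m) C (D : 'M[F]_n) :
  char_poly (block_mx A 0 C D) = char_poly A * char_poly D.
Proof.
rewrite /char_poly /char_poly_mx map_block_mx raddf0 scalar_mx_block.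
by rewrite opp_block_mx add_block_mx oppr0 addr0 det_lblock.
Qed.

Lemma char_poly_similar n (A B P : 'M[F]_n) :
  P \in unitmx -> P *m A = B *m P -> char_poly A = char_poly B.
Proof.
move=> uP eP; pose Q := map_mx polyC P.
have dQ : \det Q != 0.
  by rewrite det_map_mx polyC_eq0 -unitfE -unitmxE.
have eQ : Q *m char_poly_mx A = char_poly_mx B *m Q.
  by rewrite /char_poly_mx mulmxBr mulmxBl scalar_mxC -!map_mxM eP.
by apply: (mulfI dQ); rewrite /char_poly -det_mulmx eQ det_mulmx mulrC.
Qed.

Definition quad (a b : F) : {poly F} := ('X - a%:P) ^+ 2 + (b ^+ 2)%:P.

Lemma quad_monic a b : quad a b \is monic.
Proof.
have s3 : size (('X - a%:P) ^+ 2 : {poly F}) = 3%N by rewrite size_exp_XsubC.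
rewrite monicE lead_coefDl; first by rewrite -monicE monic_exp ?monicXsubC.
by rewrite s3; apply: leq_ltn_trans (size_polyC_leq1 _) _.
Qed.

Lemma det_mx2 (S : comNzRingType) (A : 'M[S]_2) :
  \det A = A 0 0 * A 1 1 - A 0 1 * A 1 0.
Proof.
rewrite (expand_det_row _ 0) !big_ord_recl big_ord0 addr0 /cofactor !det_mx11 !mxE /=.
rewrite [_ ^+ (0 + 0)]expr0 [_ ^+ (0 + bump 0 0)]expr1 mul1r mulN1r mulrN.
by congr (A _ _ * A _ _ - A _ _ * A _ _); apply/val_inj.
Qed.

Lemma char_poly_Kmx (a b : F) : char_poly (Kmx a b) = quad a b ^+ 2.
Proof.
rewrite -[Kmx a b](@submxK _ 2 2 2 2) (_ : ursubmx _ = 0); last first.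
  by apply/matrixP => -[[|[|?]] ?] // -[[|[|?]] ?] //; rewrite !mxE.
rewrite -[char_poly _]/(@char_poly F (2 + 2) _) char_poly_lblock expr2.
by congr (_ * _); rewrite /char_poly det_mx2 !mxE /= /quad !polyCN rmorphXn /=; ring.
Qed.

Lemma char_poly_Amx (m : F) V a1 b1 a2 b2 :
  char_poly (Amx m V (B1mx a1 b1 a2 b2))
    = ('X - m%:P) ^+ 3 * (quad a1 b1 * quad a2 b2) ^+ 2 :> {poly F}.
Proof.
rewrite /Amx /B1mx !char_poly_lblock !char_poly_Kmx exprMn; congr (_ * _).
rewrite char_poly_trig ?scalar_mx_is_trig //.
by rewrite !big_ord_recl big_ord0 !mxE /= !mulr1n mulr1.
Qed.

End CharPoly.

(** The parity of root multiplicities isolates m; the cubes then cancel, and a monic square root is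
    unique. *)
Lemma char_poly_normal_eq (R : realFieldType) (m a1 b1 a2 b2 m' a1' b1' a2' b2' : R) :
  ('X - m%:P) ^+ 3 * (quad a1 b1 * quad a2 b2) ^+ 2
    = ('X - m'%:P) ^+ 3 * (quad a1' b1' * quad a2' b2') ^+ 2 ->
  m = m' /\ quad a1 b1 * quad a2 b2 = quad a1' b1' * quad a2' b2'.
Proof.
set p := quad a1 b1 * _; set p' := quad a1' b1' * _ => E.
have pm : p \is monic by rewrite monicMl ?quad_monic.
have pm' : p' \is monic by rewrite monicMl ?quad_monic.
have p0 := monic_neq0 pm; have p0' := monic_neq0 pm'.
(* The multiplicity of m as a root of p ^+ 2 is even. *)
have mupE x y r : r != 0 :> {poly R} ->
    odd (mup x (('X - y%:P) ^+ 3 * r ^+ 2)) = (x == y).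
  move=> r0; rewrite mupM ?expf_neq0 ?polyXsubC_eq0 // mup_XsubCX expr2 mupM // addnn.
  by rewrite oddD odd_double addbF eq_sym; case: eqP.
have mm' : m = m'.
  by apply/eqP; rewrite -(mupE _ _ _ p0') -E mupE.
split=> //; move: E; rewrite mm' => /(mulfI _) /eqP; rewrite expf_neq0 ?polyXsubC_eq0 //.
(* The case p = - p' is excluded by comparing leading coefficients. *)
move=> /(_ isT); rewrite eqf_sqr => /orP[/eqP // | /eqP pN].
move/monicP: pm; rewrite pN lead_coefN (monicP pm') => /eqP.
by rewrite eq_sym -subr_eq0 opprK -mulr2n pnatr_eq0.
Qed.

Section QuadFactors.
Variable R : rcfType.
Import complex.
Local Notation q_at z a b := ((map_poly (real_complex R) (quad a b)).[z]).

Lemma quad_atE (a b a' b' : R) :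
  q_at (Complex a b) a' b' = Complex ((a - a') ^+ 2 - b ^+ 2 + b' ^+ 2) ((a - a') * b *+ 2).
Proof.
rewrite /quad rmorphD rmorphXn rmorphB /= map_polyX !map_polyC /= !hornerE.
rewrite !expr2; simpc; congr Complex; ring.
Qed.

(** The imaginary part gives a = a' or b = 0. The real part then gives the rest, in the second case
    as a vanishing sum of squares. *)
Lemma quad_root (a b a' b' : R) :
  q_at (Complex a b) a' b' = 0 -> a = a' /\ b ^+ 2 = b' ^+ 2.
Proof.
rewrite quad_atE => -[/eqP e1 /eqP].
rewrite mulrn_eq0 mulf_eq0 /= subr_eq0 => /orP[/eqP ea|/eqP b0].
  by split=> //; move: e1; rewrite ea subrr expr2 mul0r add0r addrC subr_eq0 => /eqP.
move: e1; rewrite b0 expr0n subr0 paddr_eq0 ?sqr_ge0 // !sqrf_eq0 subr_eq0.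
by move=> /andP[/eqP-> /eqP->]; rewrite expr0n.
Qed.

(** The number a_1 + i b_1 is a root of the right-hand side, hence of one of its factors; that
    factor equals [quad a1 b1] and cancels. Quadratics that split (b = 0) are covered by the same
    argument. *)
Lemma quad_mul_inj (a1 b1 a2 b2 a3 b3 a4 b4 : R) :
  quad a1 b1 * quad a2 b2 = quad a3 b3 * quad a4 b4 ->
  (a1 = a3 /\ b1 ^+ 2 = b3 ^+ 2) /\ (a2 = a4 /\ b2 ^+ 2 = b4 ^+ 2) \/
  (a1 = a4 /\ b1 ^+ 2 = b4 ^+ 2) /\ (a2 = a3 /\ b2 ^+ 2 = b3 ^+ 2).
Proof.
have q0 (a b : R) : q_at (Complex a b) a b = 0.
  by rewrite quad_atE subrr expr0n /= add0r addNr mul0r mul0rn.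
have quad_inj (a b a' b' : R) : quad a b = quad a' b' -> a = a' /\ b ^+ 2 = b' ^+ 2.
  by move=> e; apply: quad_root; rewrite -e q0.
wlog h : a3 b3 a4 b4 / q_at (Complex a1 b1) a3 b3 = 0.
  move=> H e; have : q_at (Complex a1 b1) a1 b1 * q_at (Complex a1 b1) a2 b2 = 0.
    by rewrite q0 mul0r.
  rewrite -hornerM -rmorphM e rmorphM hornerM => /eqP; rewrite mulf_eq0.
  case/orP => /eqP z; first exact: H.
  by rewrite [RHS]mulrC in e; case: (H _ _ _ _ z e); [right | left].
have [e1 e2] := quad_root h.
move=> e; left; split=> //; apply: quad_inj; move: e.
by rewrite {1}/quad e1 e2 -/(quad a3 b3); apply: mulfI; rewrite monic_neq0 ?quad_monic.
Qed.
End QuadFactors.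

(** * No repetitions in the list *)

Section Invariants.
Variable R : rcfType.

(** The characteristic polynomial yields mu and the unordered pairs (a_i, b_i^2), from which the b_i
    follow by nonnegativity; the rank of the matrix minus mu yields [nu]. *)
Lemma normal_mx_invariants (m m' : R) (nu nu' : bool) (a1 b1 a2 b2 a1' b1' a2' b2' : R) :
  0 <= b1 -> 0 <= b2 -> 0 <= b1' -> 0 <= b2' ->
  (nu -> a1 = m /\ b1 = 0) -> (nu' -> a1' = m' /\ b1' = 0) ->
  line_similar (normal_mx m nu a1 b1 a2 b2) (normal_mx m' nu' a1' b1' a2' b2') ->
  exists t, [/\ t != 0, m = t * m', nu = nu' &
     [/\ a1 = t * a1', b1 = `|t| * b1', a2 = t * a2' & b2 = `|t| * b2'] \/
     [/\ a1 = t * a2', b1 = `|t| * b2', a2 = t * a1' & b2 = `|t| * b1']].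
Proof.
move=> b10 b20 b10' b20' hnu hnu' [t [P [t0 uP] eP]].
set N := normal_mx m _ _ _ _ _ in eP; set N' := normal_mx m' _ _ _ _ _ in eP.
(* From here on [N] is conjugate to [t *: N'] in the ordinary sense. *)
rewrite scalemxAl in eP.
have cE := char_poly_similar uP eP.
rewrite /N' /normal_mx /Amx /B1mx !scale_block_mx scale_scalar_mx !scaler0 !KmxZ in cE.
rewrite !char_poly_Amx in cE.
have [mE /quad_mul_inj qE] := char_poly_normal_eq cE.
have rE : \rank (N - m%:M) = \rank (N' - m'%:M).
  have eP' : P *m (N - m%:M) = (t *: (N' - m'%:M)) *m P.
    by rewrite scalerBr scale_scalar_mx -mE mulmxBr mulmxBl eP scalar_mxC.
  rewrite -(mxrank_scale_nz (N' - m'%:M) t0) -[RHS](mxrankMfree _ (_ : row_free P)).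
    by rewrite -eP' (eqmxMfull _ (_ : row_full P)) // row_full_unit.
  by rewrite row_free_unit.
exists t; split=> //.
  rewrite !normal_mx_sub_scalar !rank_normal_mu0 ?rank_Kmx in rE; first last.
  - by move=> /hnu[-> ->]; rewrite subrr.
  - by move=> /hnu'[-> ->]; rewrite subrr.
  (* Both ranks are 3 nu plus a multiple of 4, so their residue modulo 4 determines nu. *)
  by move: rE; clear; case: nu; case: nu'; do 4!case: (_ || _).
have absE b b' : 0 <= b -> 0 <= b' -> b ^+ 2 = (t * b') ^+ 2 -> b = `|t| * b'.
  move=> h h' /(congr1 Num.sqrt).
  by rewrite !sqrtr_sqr normrM (ger0_norm h) (ger0_norm h').
case: qE => -[[eq_a1 eq_b1] [eq_a2 eq_b2]]; [left | right]; split=> //.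
- exact: absE eq_b1.
- exact: absE eq_b2.
- exact: absE eq_b1.
- exact: absE eq_b2.
Qed.

Lemma label_params_admissible (l : label R) : admissible l ->
  let: (m, nu, (a1, b1), (a2, b2)) := label_params l in
  [/\ 0 <= b1, 0 <= b2 & nu -> a1 = m /\ b1 = 0].
Proof.
case: l => /=; try by move=> *; split; rewrite ?ler01 ?lexx //; lra.
all: move=> *; split=> //; rewrite ?ler01 //; lra.
Qed.

Lemma line_similar_label_params (l l' : label R) : admissible l -> admissible l' ->
  line_similar (label_mx l) (label_mx l') -> exists t, label_params_rescale t l l'.
Proof.
move=> /label_params_admissible + /label_params_admissible; rewrite /label_mx.
rewrite /label_params_rescale.
case: (label_params l) => [[[m nu] [a1 b1]] [a2 b2]] [b10 b20 hnu].
case: (label_params l') => [[[m' nu'] [a1' b1']] [a2' b2']] [b10' b20' hnu'].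
exact: normal_mx_invariants.
Qed.

End Invariants.

Section LabelUniqueness.
Variable R : realFieldType.

(** A linear consequence common to both branches, free of absolute values and thus fit for linear
    arithmetic. *)
Lemma S2_admissibleE (a c : R) : admissible (S2 a c) -> - c <= a <= c.
Proof.
by case=> [|[a0 c0]]; [lra | rewrite ltr0_norm ?gtr0_norm //; lra].
Qed.

Ltac head t := lazymatch t with ?f _ => head f | _ => t end.
Ltac same_label := lazymatch goal with |- ?x = ?y \/ _ =>
  let hx := head x in let hy := head y in constr_eq hx hy end.

(** Once t is known, linear arithmetic settles most of the 144 pairs of families. The twins come
    from t = -1, which preserves the normalizations of [S1] and [S5]. *)
Lemma label_rescale_inj (t : R) (l l' : label R) : admissible l -> admissible l' ->
  label_params_rescale t l l' -> l' = l \/ sign_twins l l'.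
Proof.
rewrite /label_params_rescale.
case: l => [a c d|a c|a b c d|a b c|a c|c|a c d|c d|c|c|a c|c];
case: l' => [a' c' d'|a' c'|a' b' c' d'|a' b' c'|a' c'|c'|a' c' d'|c' d'|c'|c'|a' c'|c'].
all: move=> h h' [/eqP t0 m_eq nu_eq e]; try discriminate nu_eq.
all: try move/S2_admissibleE: h => h; try move/S2_admissibleE: h' => h'.
all: rewrite /= ?(mulr0, mulr1) in h h' m_eq e |- *.
all: try (exfalso; lra).
all: have u0 : 0 < `|t| by rewrite normr_gt0; apply/eqP.
(* t = 1 when mu != 0, and otherwise t = 1 or t = -1 whenever some b_i is normalized to 1. *)
all: try (exfalso; apply: t0; symmetry; exact: m_eq).
all: try (have t1 : t = 1 by (symmetry; exact: m_eq)); rewrite ?t1 ?normr1 ?mul1r in e.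
all: try case: h => h h0; try case: h' => h' h0'.
all: case: e => -[e1 e2 e3 e4].
all: try (exfalso; lra).
all: try (same_label; left; f_equal; lra).
all: try (have tpm : t = 1 \/ t = -1 by
  (have /esym := eqr_norml t 1; rewrite -?e2 -?e4 eqxx ler01 andbT => /orP[] /eqP ->; [left|right])).
all: try (case: tpm => tE; rewrite tE ?normrN1 ?normr1 ?mul1r ?mulN1r in e1 e2 e3 e4).
all: try (exfalso; lra).
all: try (same_label; left; f_equal; lra).
all: try (right; split; lra).
(* Two labels [S1] with blocks exchanged: d = |t| and |t| d' = 1, although d and d' exceed 1. *)
- by exfalso; nra.
(* Two labels [S9] with blocks in the same order, where t = 1. *)
- by left; rewrite e3 -e1 mul1r.
(* Two labels [S9] with blocks exchanged: c = t and c c' = 1 with |c|, |c'| <= 1 force c = c'. *)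
- left; congr S9; move: h h'; rewrite !ler_norml => /andP[h1 h2] /andP[h1' h2'].
  have cc : c * c' = 1 by rewrite e3.
  by apply/eqP; rewrite -subr_eq0 -sqrf_eq0 eq_le sqr_ge0 andbT; nra.
(* For [S10], in either order of the blocks, t != 0 keeps the values 0 and 1 apart. *)
- left; congr S10; case: h h' => h [] h'; move: e3; rewrite h h'; rewrite ?mulr0 ?mulr1; lra.
- by left; congr S10; case: h h' => h [] h'; move: e1 e3; rewrite h h' ?mulr1; lra.
Qed.
End LabelUniqueness.

(** * The classification *)

(** The inclusion of F^8 is injective and intertwines [I k] with [J k], so the quaternionic
    relations descend to the matrices. *)
Lemma restricted_quaternions (F : fieldType) (A : 'M[F]_(3 + (4 + 4)))
    (J : 'I_3 -> 'End(semidirect A)) (I : 'I_3 -> 'M[F]_(4 + 4)) :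
  hypercomplex_structure J -> (forall k v, J k (incl8 A v) = incl8 A (I k *m v)) ->
  [/\ forall k, I k *m I k = - 1%:M, I 0 *m I 1 = I 2 & I 1 *m I 0 = - I 2].
Proof.
move=> [cJ J01 J10] JI.
have incl_inj : injective (incl8 A) by move=> v w /(congr1 snd) /eq_col_mx[].
have inclN v : incl8 A (- v) = - incl8 A v.
  by rewrite /incl8; congr pair; rewrite /= ?oppr0 // opp_col_mx oppr0.
have mx_ext (B C : 'M[F]_(4 + 4)) : (forall v : 'cV_(4 + 4), B *m v = C *m v) -> B = C.
  by move=> BC; apply/matrixP => i j; have /matrixP/(_ i 0) := BC (delta_mx j 0); rewrite -!colE !mxE.
split=> [k||].
- apply: mx_ext => v; apply: incl_inj; rewrite -mulmxA -!JI (proj1 (cJ k)) -inclN.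
  by rewrite mulNmx mul1mx.
- by apply: mx_ext => v; apply: incl_inj; rewrite -mulmxA -!JI J01.
- by apply: mx_ext => v; apply: incl_inj; rewrite -mulmxA -!JI J10 JI mulNmx inclN.
Qed.

Lemma normal_mx0 (F : fieldType) : normal_mx 0 false 0 0 0 0 = 0 :> 'M[F]_(3 + (4 + 4)).
Proof. by rewrite /normal_mx /Amx /B1mx Kmx_scalar scale0r !raddf0 !block_mx0. Qed.

Lemma line_similar0 (F : fieldType) n (A : 'M[F]_n) : line_similar A 0 -> A = 0.
Proof.
by case=> t [P [_ uP]]; rewrite mul0mx scaler0 => /(canRL (mulKmx uP)); rewrite mulmx0.
Qed.

Lemma semidirect0_abelian (F : fieldType) n : lie_abelian (semidirect (0 : 'M[F]_n)).
Proof. by move=> x y; rewrite semidirect_bracketE !mul0mx !scaler0 subr0. Qed.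

Theorem theorem5p1 (R : realType) (mu a1 a2 b1 b2 : R)
    (b1_ge0 : 0 <= b1) (b2_ge0 : 0 <= b2)
    (V : 'M[R]_(4 + 4, 3)) (v0 : 'cV[R]_(4 + 4))
    (A : 'M[R]_(3 + (4 + 4))) (A_def : A = Amx mu V (B1mx a1 b1 a2 b2))
    (A_nonabelian : ~ lie_abelian (semidirect A))
    (J : 'I_3 -> 'End(semidirect A)) (J_hyp : hypercomplex_structure J)
    (J8 : 'I_3 -> 'M[R]_(4 + 4))
    (J8_restr : forall k v, J k (incl8 A v) = incl8 A (J8 k *m v))
    (J8_u : forall k, J8 k *m u_ R ord0 = u_ R (lift ord0 k))
    (J8_w : forall k, J8 k *m w_ R ord0 = w_ R (lift ord0 k))
    (J8_B1 : forall k, B1mx a1 b1 a2 b2 *m J8 k = J8 k *m B1mx a1 b1 a2 b2)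
    (V_cols : forall k, col k V = J8 k *m v0) :
  (exists2 l : label R, admissible l & lie_isomorphic (semidirect A) (s_ l)) /\
  (forall l l' : label R, admissible l -> admissible l' ->
     lie_isomorphic (semidirect A) (s_ l) ->
     lie_isomorphic (semidirect A) (s_ l') ->
     l' = l \/ sign_twins l l').
Proof.
split; last first.
  move=> l l' adm adm' /(iso_s_iff _ adm) Al /(iso_s_iff _ adm') Al'.
  have ll' := line_similar_trans (line_similar_sym Al) Al'.
  have [t] := line_similar_label_params adm adm' ll'.
  exact: label_rescale_inj.
have [I_sq I01 I10] := restricted_quaternions J_hyp J8_restr.
have eV := quaternionic_columnsE I_sq I01 I10 J8_u J8_w V_cols.
suff [l adm Al] : exists2 l, admissible l & line_similar A (label_mx l).
  by exists l => //; apply/iso_s_iff.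
have via m nu c1 d1 c2 d2 : line_similar A (normal_mx m nu c1 d1 c2 d2) ->
    has_label m nu c1 d1 c2 d2 -> exists2 l, admissible l & line_similar A (label_mx l).
  by move=> AN [l adm Nl]; exists l => //; apply: line_similar_trans Nl.
have := Amx_normal mu a1 b1 a2 b2 (usubmx v0) (dsubmx v0).
rewrite -eV -A_def => -[] AN; apply: (via _ _ _ _ _ _ AN);
  [ | exact: has_label_nilpotent | exact: has_label_nilpotent].
have [mu0|mu0] := eqVneq mu 0; last exact: has_label_mu_neq0.
rewrite mu0 in AN *; apply: has_label_mu0 => //.
(* If all parameters vanished, A would be similar to 0 and the algebra abelian. *)
apply/negPn/negP; rewrite !negb_or !negbK => /and4P[/eqP z1 /eqP z2 /eqP z3 /eqP z4].
apply: A_nonabelian; have -> : A = 0; last exact: semidirect0_abelian.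
by move: AN; rewrite z1 z2 z3 z4 normal_mx0; apply: line_similar0.
Qed.
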